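(* (1) On the space $\mathrm{Conf}(12)[1]$ there is a continuous deformation of the DOD configuration to the FCC configuration that remains in the interior $\mathrm{Conf}^+(12)[1]$ until the final instant; i.e. there is a continuous path $\gamma:[0,1]\to\mathrm{Conf}(12)[1]$ with $\gamma(0)$ a DOD configuration, $\gamma(1)$ an FCC configuration, and $\gamma(t)\in\mathrm{Conf}^+(12)[1]$ for all $0\le t<1$. (2) There is also a continuous deformation of the DOD configuration to the HCP configuration that remains in the interior $\mathrm{Conf}^+(12)[1]$ until the final instant; i.e. there is a continuous path $\gamma:[0,1]\to\mathrm{Conf}(12)[1]$ with $\gamma(0)$ a DOD configuration, $\gamma(1)$ an HCP configuration, and $\gamma(t)\in\mathrm{Conf}^+(12)[1]$ for all $0\le t<1$.
   Context: $\mathrm{Conf}(12)[1]$ is the configuration space of $12$ labeled unit spheres with disjoint interiors all touching a central unit sphere $\mathbb S^2\subset\mathbb R^3$, recorded by the touching points: it is the set of $(\mathbf u_1,\dots,\mathbf u_{12})\in(\mathbb S^2)^{12}$ with pairwise angular distances $\theta(\mathbf u_i,\mathbf u_j)\ge\pi/3$ for $i\ne j$. Its interior $\mathrm{Conf}^+(12)[1]$ is the subset where $\theta(\mathbf u_i,\mathbf u_j)>\pi/3$ for all $i\neq j$. DOD configuration: the touching points are the $12$ vertices of a regular icosahedron inscribed in $\mathbb S^2$ (with some labeling). FCC configuration: the touching points are the $12$ vertices of a cuboctahedron inscribed in $\mathbb S^2$; up to rotation, six points on the equator $z=0$ at longitudes $k\pi/3$, three points at height $z=\sqrt{2/3}$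 at longitudes $\pi/6+2\pi k/3$, and three points at height $z=-\sqrt{2/3}$ at longitudes $\pi/2+2\pi k/3$. HCP configuration: the touching points are the $12$ vertices of a triangular orthobicupola inscribed in $\mathbb S^2$; up to rotation, the same equatorial points and the same three points at height $\sqrt{2/3}$, together with the reflections of these three points in the plane $z=0$. *)

(* Defs.v *)
From mathcomp Require Import all_boot all_order all_algebra.
From mathcomp Require Import all_classical all_reals all_analysis.
Import Order.TTheory GRing.Theory Num.Theory.
Import numFieldNormedType.Exports.

Set Implicit Arguments.
Unset Strict Implicit.
Unset Printing Implicit Defensive.

Local Open Scope classical_set_scope.
Local Open Scope ring_scope.

(* Points of R^3 are row vectors; a configuration of 12 labeled points is a
   12 x 3 matrix whose i-th row is the i-th point. The topology on matrices is
   the entrywise one, i.e. the product topology of (R^3)^12. *)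

Section TwelveSpheres.
Variable R : realType.
Implicit Types (u v : 'rV[R]_3) (U : 'M[R]_(12, 3)) (V : set 'rV[R]_3).

Definition vec3 (x y z : R) : 'rV[R]_3 := \row_(j < 3) [:: x; y; z]`_j.

Definition dot u v : R := \sum_(j < 3) u 0 j * v 0 j.

Definition sphere2 : set 'rV[R]_3 := [set u | dot u u = 1].

(* [acos] is only meaningful on [-1, 1], where [dot u v] lies for u, v unit. *)
Definition angle u v : R := acos (dot u v).

Definition Conf12 : set 'M[R]_(12, 3) :=
  [set U | (forall i, sphere2 (row i U)) /\
           (forall i j, i != j -> pi / 3 <= angle (row i U) (row j U))].

Definition Conf12_plus : set 'M[R]_(12, 3) :=
  [set U | (forall i, sphere2 (row i U)) /\
           (forall i j, i != j -> pi / 3 < angle (row i U) (row j U))].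

Definition is_rotation (Q : 'M[R]_3) : Prop := Q *m Q^T = 1%:M /\ \det Q = 1.

(* The rows of U enumerate, in some order and without repetition, the image
   of V under some rotation. *)
Definition labeled_copy V U : Prop :=
  exists2 Q : 'M[R]_3, is_rotation Q &
    set_bij [set: 'I_12] [set v *m Q | v in V] (fun i => row i U).

Definition golden : R := (1 + Num.sqrt 5) / 2.

(* The cyclic permutations of (0, +-1, +-golden), scaled to unit length. *)
Definition icosahedron : set 'rV[R]_3 :=
  [set v | exists a b : bool,
    let p := (-1) ^+ a / Num.sqrt (1 + golden ^+ 2) in
    let q := (-1) ^+ b * golden / Num.sqrt (1 + golden ^+ 2) in
    [\/ v = vec3 0 p q, v = vec3 q 0 p | v = vec3 p q 0]].

Definition height_longitude (z l : R) : 'rV[R]_3 :=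
  vec3 (Num.sqrt (1 - z ^+ 2) * cos l) (Num.sqrt (1 - z ^+ 2) * sin l) z.

Definition equator6 : set 'rV[R]_3 :=
  [set height_longitude 0 (k%:R * pi / 3) | k in `I_6].

(* Three points at height z, at longitudes l, l + 2 pi / 3, l + 4 pi / 3. *)
Definition triangle (z l : R) : set 'rV[R]_3 :=
  [set height_longitude z (l + 2 * pi * k%:R / 3) | k in `I_3].

Definition cuboctahedron : set 'rV[R]_3 :=
  equator6 `|` triangle (Num.sqrt (2 / 3)) (pi / 6)
           `|` triangle (- Num.sqrt (2 / 3)) (pi / 2).

Definition reflect_z u : 'rV[R]_3 := vec3 (u 0 0) (u 0 1) (- u 0 2).

Definition triangular_orthobicupola : set 'rV[R]_3 :=
  equator6 `|` triangle (Num.sqrt (2 / 3)) (pi / 6)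
           `|` reflect_z @` triangle (Num.sqrt (2 / 3)) (pi / 6).

Definition is_DOD U : Prop := labeled_copy icosahedron U.
Definition is_FCC U : Prop := labeled_copy cuboctahedron U.
Definition is_HCP U : Prop := labeled_copy triangular_orthobicupola U.

End TwelveSpheres.

(* Main.v *)
Require Import Defs.
From mathcomp Require Import all_boot all_order all_algebra.
From mathcomp Require Import all_classical all_reals all_analysis.
From mathcomp Require Import ring lra.
Import Order.TTheory GRing.Theory Num.Theory.
Import numFieldNormedType.Exports.

(** Both deformations are explicit. Two unit vectors are at angle at least
    [pi / 3] exactly when their dot product is at most [1 / 2], so everything
    reduces to bounding the 66 dot products of twelve points given by formulas;
    the symmetry of the motions leaves only a handful of distinct values.

    The first motion is Buckminster Fuller's jitterbug. For
    [a ^+ 2 + b ^+ 2 = 1] take the cyclic permutations of [(0, +-a, +-b)]. The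
    dot products are [-1], [+-a * b] and [+-(b ^+ 2 - a ^+ 2)]. The
    icosahedron is [b = golden * a], the cuboctahedron is [a = b], and
    [a * b <= 1 / 2] with equality only for [a = b]; see [jitterbug_dot] and [FCC_path_Conf].

    The second motion keeps the rotations of a triangular prism. With the
    threefold axis vertical, the orthobicupola consists of a hexagonal equator
    and of two polar triangles on the same longitudes. Turn the two triangles
    in opposite directions, while alternate points of the equator move up and
    down; after a relative turn of [pi / 3] this is an icosahedron. A
    polar point touches two equatorial points. The turn brings it closer to
    one of them and farther from the other, to first order, and the heights
    of the equatorial points are chosen to keep the two distances
    equal. What remains is of second order and favourable, as long as the polar
    triangles do not expand too fast, which the choice of [cap_radial]
    ensures; see [twisted_dot] and [twist_Conf].

    The endpoints are identified by an explicit rotation between the coordinates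
    adapted to the cube and those adapted to the threefold axis, in
    [is_DOD_jitterbug], [is_FCC_jitterbug], [is_DOD_twisted] and
    [is_HCP_twisted]. *)

Local Open Scope classical_set_scope.
Local Open Scope ring_scope.

Section TwelveSpheres.
Variable R : realType.
Implicit Types (a b c x y z h l m t : R) (u v : 'rV[R]_3) (s : seq 'rV[R]_3).

(** * Angles of sixty degrees *)

Lemma sqrtr_eq x y : 0 <= y -> x = y ^+ 2 -> Num.sqrt x = y.
Proof. by move=> y0 ->; rewrite sqrtr_sqr ger0_norm. Qed.

(** The cosine [c] of [pi / 3] satisfies [2 c ^+ 2 - 1 = - c], because
    [2 pi / 3] is the supplement of [pi / 3]. *)
Lemma cos_pi3 : cos (pi / 3) = 2^-1 :> R.
Proof.
have pi0 := @pi_gt0 R.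
have c0 : 0 < cos (pi / 3 : R) by apply: cos_gt0_pihalf; lra.
have : cos ((pi / 3) *+ 2) = - cos (pi / 3) :> R.
  by rewrite -[in RHS]cosN -cosDpi; congr cos; rewrite mulr2n; field.
rewrite cos_mulr2n => e.
have : (cos (pi / 3) + 1) * (2 * cos (pi / 3) - 1) = 0 :> R by lra.
by move/eqP; rewrite mulf_eq0 => /orP[]/eqP ?; lra.
Qed.

Lemma sin_pi3 : sin (pi / 3) = Num.sqrt 3 / 2 :> R.
Proof.
have pi0 := @pi_gt0 R.
have s0 : 0 < sin (pi / 3 : R) by apply: sin_gt0_pi; lra.
rewrite -[LHS]ger0_norm ?ltW// -sqrtr_sqr sin2cos2 cos_pi3.
have -> : 1 - 2^-1 ^+ 2 = 3 * 2^-1 ^+ 2 :> R by field.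
by rewrite sqrtrM// sqrtr_sqr ger0_norm.
Qed.

Lemma cos_pi6 : cos (pi / 6) = Num.sqrt 3 / 2 :> R.
Proof. by rewrite -sin_pi3 -cosBpihalf -cosN; congr cos; field. Qed.

Lemma sin_pi6 : sin (pi / 6) = 2^-1 :> R.
Proof.
by rewrite -cos_pi3 -[LHS]opprK -sinN -cosDpihalf; congr cos; field.
Qed.

Lemma dotC u v : dot u v = dot v u.
Proof. by apply: eq_bigr => i _; rewrite mulrC. Qed.

Lemma dot_le1 u v : dot u u = 1 -> dot v v = 1 -> -1 <= dot u v <= 1.
Proof.
move=> u1 v1.
(* This is the squared norm of [u + c v]; [c = 1] and [c = -1] give the two
   bounds. *)
have sq c : 0 <= dot u u + (2 * c * dot u v + c ^+ 2 * dot v v).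
  rewrite /dot !mulr_sumr -!big_split; apply: sumr_ge0 => j _ /=.
  rewrite [leRHS](_ : _ = (u 0 j + c * v 0 j) ^+ 2); last by ring.
  exact: sqr_ge0.
have := sq 1; have := sq (-1); rewrite u1 v1 => h1 h2.
by apply/andP; split; lra.
Qed.

Lemma acos_itv u v : dot u u = 1 -> dot v v = 1 -> angle u v \in `[0, pi].
Proof.
by move=> u1 v1; rewrite in_itv/= acos_ge0 ?acos_lepi ?dot_le1.
Qed.

Lemma cos_angle u v : dot u u = 1 -> dot v v = 1 -> cos (angle u v) = dot u v.
Proof. by move=> u1 v1; rewrite acosK ?in_itv/= ?dot_le1. Qed.

Lemma pi3_itv : pi / 3 \in `[0, pi : R].
Proof. by have := @pi_gt0 R; rewrite in_itv/= => ?; apply/andP; split; lra. Qed.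

Lemma pi3_le_angle u v : dot u u = 1 -> dot v v = 1 ->
  (pi / 3 <= angle u v) = (dot u v <= 2^-1).
Proof.
move=> u1 v1.
by rewrite -cos_pi3 -cos_angle// !leNgt ltr_cos ?acos_itv ?pi3_itv.
Qed.

Lemma pi3_lt_angle u v : dot u u = 1 -> dot v v = 1 ->
  (pi / 3 < angle u v) = (dot u v < 2^-1).
Proof.
by move=> u1 v1; rewrite -cos_pi3 -cos_angle// ltr_cos ?acos_itv ?pi3_itv.
Qed.

(** * Configurations given by lists of points *)

Definition config s : 'M[R]_(12, 3) := \matrix_(i < 12) s`_i.

Lemma row_config s i : row i (config s) = s`_i.
Proof. exact: rowK. Qed.

Lemma config_dot m s : size s = 12%N -> pairwise (fun u v => dot u v <= m) s ->
  forall i j : 'I_12, i != j -> dot s`_i s`_j <= m.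
Proof.
move=> s12 /(pairwiseP 0) sm i j; rewrite neq_ltn => /orP[] ij; last rewrite dotC;
  by apply: sm; rewrite ?inE ?s12.
Qed.

Definition unit_list s := all (fun u => dot u u == 1) s.

Lemma config_unit s (i : 'I_12) : size s = 12%N -> unit_list s ->
  dot s`_i s`_i = 1.
Proof. by move=> s12 /all_nthP-/(_ 0 i) h; apply/eqP/h; rewrite s12. Qed.

(** The bound [m] lets one estimate of the dot products serve both for the
    closed configuration space, at the final instant, and for its interior. *)
Lemma config_Conf12 m s : m <= 2^-1 -> size s = 12%N -> unit_list s ->
  pairwise (fun u v => dot u v <= m) s -> Conf12 (config s).
Proof.
move=> m2 s12 s1 sm; have u1 (i : 'I_12) := config_unit s i s12 s1.
split=> [i|i j ij]; first by rewrite row_config /sphere2/= u1.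
by rewrite !row_config pi3_le_angle ?u1// (le_trans _ m2)// config_dot.
Qed.

Lemma config_Conf12_plus m s : m < 2^-1 -> size s = 12%N -> unit_list s ->
  pairwise (fun u v => dot u v <= m) s -> Conf12_plus (config s).
Proof.
move=> m2 s12 s1 sm; have u1 (i : 'I_12) := config_unit s i s12 s1.
split=> [i|i j ij]; first by rewrite row_config /sphere2/= u1.
by rewrite !row_config pi3_lt_angle ?u1// (le_lt_trans _ m2)// config_dot.
Qed.

(** A repeated point would make a zero angle, so the injectivity required of a
    labeling is automatic. *)
Lemma Conf12_row_inj (U : 'M[R]_(12, 3)) : Conf12 U -> injective (fun i => row i U).
Proof.
move=> [U1 Upi] i j ij; apply: contraPeq (Upi i j) => nij /(_ nij).
by rewrite pi3_le_angle ?U1// -[row j U]ij U1; lra.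
Qed.

Lemma labeled_copy_config (V : set 'rV[R]_3) (s0 s : seq 'rV[R]_3) (Q : 'M[R]_3) :
  is_rotation Q -> V = [set` s0] -> map (mulmx^~ Q) s0 = s ->
  size s = 12%N -> Conf12 (config s) -> labeled_copy V (config s).
Proof.
move=> rotQ -> {V} <- {s} s12 Us; exists Q => //; rewrite size_map in s12.
split=> [i _|i j _ _|_ [v /= vs <-]].
- rewrite row_config (nth_map 0) ?s12//; exists s0`_i => //=.
  by rewrite mem_nth ?s12.
- exact: Conf12_row_inj.
- have v12 : (index v s0 < 12)%N by rewrite -s12 index_mem.
  exists (Ordinal v12) => //.
  by rewrite row_config (nth_map 0) ?s12//= nth_index.
Qed.

Lemma continuous_config (f : R -> seq 'rV[R]_3) (t : R) :
  (forall (i : 'I_12) j, {for t, continuous (fun t => (f t)`_i 0 j)}) ->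
  {for t, continuous (fun t => config (f t))}.
Proof.
move=> fc A [P AP PA].
have near_forall (I : finType) (G : I -> set R) :
    (forall i, \forall t' \near t, G i t') -> \forall t' \near t, forall i, G i t'.
  exact: (filter_forall (nbhs_filter t)).
suff : \forall t' \near t, forall i j, P i j (config (f t') i j).
  by apply: filterS => t'; exact: PA.
apply: (near_forall _ (fun i t' => forall j, P i j (config (f t') i j))) => i.
apply: near_forall => j.
change (nbhs t (fun t' => P i j (config (f t') i j))).
rewrite (_ : (fun t' => _) = (fun t' => P i j ((f t')`_i 0 j))); last first.
  by apply/funext => t'; rewrite mxE.
by apply: fc; have := AP i j; rewrite mxE.
Qed.

Lemma ord3P (P : 'I_3 -> Prop) : P 0 -> P 1 -> P (2%:R) -> forall i, P i.
Proof.
move=> P0 P1 P2 [[|[|[|//]]] i3].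
- by have -> : Ordinal i3 = 0 by apply: val_inj.
- by have -> : Ordinal i3 = 1 by apply: val_inj.
- by have -> : Ordinal i3 = 2%:R by apply: val_inj.
Qed.

(** With [continuous_nil] and [continuous_config], this reduces the continuity
    of a path of configurations to that of the coordinates of each point. *)
Lemma continuous_cons (f g k : R -> R) (F : R -> seq 'rV[R]_3) t :
  {for t, continuous f} -> {for t, continuous g} -> {for t, continuous k} ->
  (forall i j, {for t, continuous (fun t' => (F t')`_i 0 j)}) ->
  forall i j, {for t, continuous (fun t' => (vec3 (f t') (g t') (k t') :: F t')`_i 0 j)}.
Proof.
move=> fc gc kc Fc [|i] j; last exact: Fc.
move: j; apply: ord3P => /=.
- by rewrite (_ : (fun _ => _) = f)//; apply/funext => t'; rewrite mxE.
- by rewrite (_ : (fun _ => _) = g)//; apply/funext => t'; rewrite mxE.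
- by rewrite (_ : (fun _ => _) = k)//; apply/funext => t'; rewrite mxE.
Qed.

Lemma continuous_nil t i j :
  {for t, continuous (fun t' : R => ([::] : seq 'rV[R]_3)`_i 0 j)}.
Proof. exact: cst_continuous. Qed.

(** * Rotations of space *)

Lemma vec3_mulmx x y z (Q : 'M[R]_3) : vec3 x y z *m Q =
  vec3 (x * Q 0 0 + y * Q 1 0 + z * Q (2%:R) 0) (x * Q 0 1 + y * Q 1 1 + z * Q (2%:R) 1)
  (x * Q 0 (2%:R) + y * Q 1 (2%:R) + z * Q (2%:R) (2%:R)).
Proof.
by apply/rowP; apply: ord3P; rewrite !mxE !big_ord_recl big_ord0 !mxE/= addr0 addrA;
  congr (_ * Q _ _ + _ * Q _ _ + _ * Q _ _); apply: val_inj.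
Qed.

Lemma dot_vec3 x y z x' y' z' :
  dot (vec3 x y z) (vec3 x' y' z') = x * x' + y * y' + z * z'.
Proof. by rewrite /dot !big_ord_recl big_ord0 !mxE/= addr0 addrA. Qed.

Definition mx3 (a b c : 'rV[R]_3) : 'M[R]_3 := \matrix_(i < 3) [:: a; b; c]`_i.

(** The third row is the cross product of the other two, which fixes the sign of
    the determinant. *)
Lemma mx3_rotation (a1 a2 a3 b1 b2 b3 c1 c2 c3 : R) :
  a1 * a1 + a2 * a2 + a3 * a3 = 1 -> b1 * b1 + b2 * b2 + b3 * b3 = 1 ->
  a1 * b1 + a2 * b2 + a3 * b3 = 0 ->
  c1 = a2 * b3 - a3 * b2 -> c2 = a3 * b1 - a1 * b3 -> c3 = a1 * b2 - a2 * b1 ->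
  is_rotation (mx3 (vec3 a1 a2 a3) (vec3 b1 b2 b3) (vec3 c1 c2 c3)).
Proof.
move=> aa bb ab -> -> ->.
(* Lagrange's identity for the norm of a cross product. *)
have det1 : (a2 * b3 - a3 * b2) ^+ 2 + (a3 * b1 - a1 * b3) ^+ 2
  + (a1 * b2 - a2 * b1) ^+ 2 = 1.
  transitivity ((a1 * a1 + a2 * a2 + a3 * a3) * (b1 * b1 + b2 * b2 + b3 * b3)
                - (a1 * b1 + a2 * b2 + a3 * b3) ^+ 2); first by ring.
  by rewrite aa bb ab; ring.
split.
  apply/matrixP; apply: ord3P; apply: ord3P;
  rewrite !mxE !big_ord_recl big_ord0 !mxE/= ?eqxx /=; try lra.
rewrite (expand_det_row _ 0) !big_ord_recl big_ord0 /cofactor.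
rewrite !(expand_det_row _ 0) !big_ord_recl !big_ord0 /cofactor !det_mx11.
by rewrite !mxE/=; lra.
Qed.

Lemma trmx_rotation (Q : 'M[R]_3) : is_rotation Q -> is_rotation Q^T.
Proof. by move=> [QQ detQ]; split; rewrite ?det_tr// trmxK; exact: mulmx1C. Qed.

Lemma rotation1 : is_rotation (1%:M : 'M[R]_3).
Proof. by split; rewrite ?det1// trmx1 mulmx1. Qed.

(** * Threefold coordinates and the two bicupolas *)

Local Notation sqrt3 := (Num.sqrt (3 : R)).

Lemma sqrt3K : sqrt3 ^+ 2 = 3.
Proof. by rewrite sqr_sqrtr. Qed.

Lemma sqrt3M : sqrt3 * sqrt3 = 3.
Proof. by rewrite -expr2 sqrt3K. Qed.

(** With the factor [sqrt3] taken out of the second coordinate, rotations by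
    multiples of [pi / 3] around the vertical axis have rational coefficients. *)
Definition hex x h z := vec3 x (sqrt3 * h) z.

Lemma dot_hex x h z x' h' z' :
  dot (hex x h z) (hex x' h' z') = x * x' + 3 * (h * h') + z * z'.
Proof. by rewrite dot_vec3 mulrACA sqrt3M. Qed.

(** The orbit of a point under the rotations by [2 pi / 3] around the vertical
    axis. *)
Definition tri x h z : seq 'rV[R]_3 :=
  [:: hex x h z; hex (- (x + 3 * h) / 2) ((x - h) / 2) z;
      hex ((3 * h - x) / 2) (- (x + h) / 2) z].

Lemma hex_longitudeD x h z l : height_longitude z l = hex x h z ->
  height_longitude z (l + 2 * pi / 3) = hex (- (x + 3 * h) / 2) ((x - h) / 2) z.
Proof.
have c23 : cos (2 * pi / 3) = - 2^-1 :> R.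
  by rewrite -cos_pi3 -[in RHS]cosN -cosDpi; congr cos; field.
have s23 : sin (2 * pi / 3) = sqrt3 / 2 :> R.
  by rewrite -sin_pi3 -[RHS]opprK -[in RHS]sinN -sinDpi; congr sin; field.
rewrite /height_longitude; set rho := Num.sqrt _ => /rowP e.
have := e 0; have := e 1; rewrite !mxE/= => es ec.
by rewrite cosD sinD c23 s23 !mulrDr !mulrN !mulrA ec es; congr vec3; field: sqrt3K.
Qed.

Lemma triangle_seq x h z l : height_longitude z l = hex x h z ->
  triangle z l = [set` tri x h z].
Proof.
move=> e0; have e1 := hex_longitudeD _ _ _ _ e0; have e2 := hex_longitudeD _ _ _ _ e1.
have k0 : height_longitude z (l + 2 * pi * 0%:R / 3) = hex x h z.
  by rewrite mulr0 mul0r addr0.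
have k1 : height_longitude z (l + 2 * pi * 1%:R / 3) = hex (- (x + 3 * h) / 2) ((x - h) / 2) z.
  by rewrite mulr1.
have k2 : height_longitude z (l + 2 * pi * 2%:R / 3) = hex ((3 * h - x) / 2) (- (x + h) / 2) z.
  by rewrite (_ : l + _ = l + 2 * pi / 3 + 2 * pi / 3) ?e2; [congr hex|]; field.
rewrite /triangle; apply/seteqP; split=> [_ [[|[|[|//]]] /= _ <-]|v /=].
- by rewrite k0 !inE eqxx.
- by rewrite k1 !inE eqxx orbT.
- by rewrite k2 !inE eqxx !orbT.
- by rewrite !inE => /or3P[] /eqP ->; [exists 0%N|exists 1%N|exists 2%N].
Qed.

(** Even and odd multiples of [pi / 3] form the two triangles. *)
Lemma equator6_triangles : @equator6 R = triangle 0 0 `|` triangle 0 (pi / 3).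
Proof.
apply/seteqP; split=> [_ [k /= k6 <-]|_ [] [k /= k3 <-]].
- rewrite -(odd_double_half k); case: (odd k).
    right; exists k./2; first by move: k6; do 6?[case: k => [//|k]].
    by congr height_longitude; rewrite /= natrD -muln2 natrM; field.
  left; exists k./2; first by move: k6; do 6?[case: k => [//|k]].
  by congr height_longitude; rewrite /= natrD -muln2 natrM; field.
- exists k.*2; first by move: k3; do 3?[case: k => [//|k]].
  by congr height_longitude; rewrite -muln2 natrM; field.
- exists k.*2.+1; first by move: k3; do 3?[case: k => [//|k]].
  by congr height_longitude; rewrite -natr1 -muln2 natrM; field.
Qed.

Lemma setU_seq s s' : [set` s] `|` [set` s'] = [set` s ++ s'].
Proof.
by apply/seteqP; split=> v /=; rewrite mem_cat => /orP.
Qed.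

Local Notation polar_z := (Num.sqrt (2 / 3 : R)).

Lemma radius_polar : Num.sqrt (1 - polar_z ^+ 2) = sqrt3 / 3.
Proof.
rewrite sqr_sqrtr// (_ : 1 - 2 / 3 = 3 / 3 ^+ 2); last by field.
by rewrite sqrtrM// sqrtrV// sqrtr_sqr ger0_norm.
Qed.

Lemma equator6_seq : @equator6 R = [set` tri 1 0 0 ++ tri 2^-1 2^-1 0].
Proof.
rewrite equator6_triangles -setU_seq; congr (_ `|` _); apply: triangle_seq.
  by rewrite /height_longitude expr0n subr0 sqrtr1 cos0 sin0 /hex !mul1r mulr0.
by rewrite /height_longitude expr0n subr0 sqrtr1 cos_pi3 sin_pi3 /hex !mul1r.
Qed.

Lemma triangle_north : triangle polar_z (pi / 6) = [set` tri 2^-1 6^-1 polar_z].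
Proof.
apply: triangle_seq; rewrite /height_longitude radius_polar cos_pi6 sin_pi6 /hex.
by congr vec3; field: sqrt3K.
Qed.

Lemma triangle_south : triangle (- polar_z) (pi / 2) = [set` tri 0 3^-1 (- polar_z)].
Proof.
apply: triangle_seq; rewrite /height_longitude sqrrN radius_polar cos_pihalf.
by rewrite sin_pihalf /hex; congr vec3; field.
Qed.

Lemma cuboctahedron_seq : @cuboctahedron R =
  [set` tri 1 0 0 ++ tri 2^-1 2^-1 0 ++ tri 2^-1 6^-1 polar_z ++ tri 0 3^-1 (- polar_z)].
Proof.
by rewrite /cuboctahedron equator6_seq triangle_north triangle_south !setU_seq -!catA.
Qed.

Lemma reflect_tri x h z : @reflect_z R @` [set` tri x h z] = [set` tri x h (- z)].
Proof.
have E x' h' : reflect_z (hex x' h' z) = hex x' h' (- z) by rewrite /reflect_z !mxE.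
apply/seteqP; split=> [_ [v /= vt <-]|v].
  by move: vt; rewrite !inE => /or3P[] /eqP->; rewrite E eqxx ?orbT.
by rewrite /= !inE => /or3P[] /eqP->; rewrite -E; eexists=> //=; rewrite !inE eqxx ?orbT.
Qed.

(** The equatorial triangle through longitude [pi / 3] is listed from longitude
    [- pi / 3], which is where [twisted] starts the corresponding orbit. *)
Lemma orthobicupola_seq : @triangular_orthobicupola R =
  [set` tri (1 / 2) (- 1 / 2) 0 ++ tri 1 0 0 ++
        tri 2^-1 6^-1 polar_z ++ tri 2^-1 6^-1 (- polar_z)].
Proof.
rewrite /triangular_orthobicupola equator6_seq triangle_north reflect_tri.
rewrite !setU_seq -!catA !catA -!setU_seq; congr (_ `|` _ `|` _).
have -> : tri 2^-1 2^-1 0 = rot 1 (tri (1 / 2) (- 1 / 2) 0).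
  by rewrite /tri /rot/=; congr [:: _; _; _]; congr hex; field.
by rewrite setUC; congr (_ `|` _); apply/seteqP; split=> v /=; rewrite mem_rot.
Qed.

(** * The icosahedron *)

(** Cyclic permutation of coordinates is the rotation by [2 pi / 3] around
    [(1, 1, 1)]. *)
Definition cyc x y z : seq 'rV[R]_3 := [:: vec3 x y z; vec3 z x y; vec3 y z x].

(** The cyclic permutations of [(0, +-a, +-b)], in four orbits that correspond,
    in this order, to those of [cuboctahedron_seq] and of [twisted]. *)
Definition jitterbug a b :=
  cyc (- a) b 0 ++ cyc (- b) 0 a ++ cyc 0 a b ++ cyc (- a) (- b) 0.

Local Notation phi := (golden R).

Lemma golden_sq : phi ^+ 2 = phi + 1.
Proof. by rewrite /golden; field: (@sqr_sqrtr R 5 ltac:(done)). Qed.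

Lemma golden_gt : 8 / 5 < phi.
Proof.
have s5 : 11 / 5 < Num.sqrt 5 :> R.
  rewrite -[ltLHS]ger0_norm// -sqrtr_sqr ltr_sqrt//; lra.
rewrite /golden; lra.
Qed.

Lemma golden_lt : phi < 17 / 10.
Proof. have g := golden_gt; have g2 := golden_sq; nra. Qed.

(** [ico_a] and [ico_b] are the absolute values of the nonzero coordinates of the
    vertices of the icosahedron. *)
Definition ico_a : R := 1 / Num.sqrt (1 + phi ^+ 2).
Definition ico_b : R := phi * ico_a.

Lemma ico_a_gt0 : 0 < ico_a.
Proof. by rewrite divr_gt0// sqrtr_gt0 ltr_pwDl// sqr_ge0. Qed.

Lemma ico_a_sq : ico_a ^+ 2 * (phi + 2) = 1.
Proof.
have g := golden_gt; rewrite /ico_a expr_div_n expr1n sqr_sqrtr; last first.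
  by rewrite addr_ge0// sqr_ge0.
by rewrite golden_sq; field; apply: lt0r_neq0; lra.
Qed.

Lemma icosahedron_seq : @icosahedron R = [set` jitterbug ico_a ico_b].
Proof.
have pE (c : bool) : (-1) ^+ c / Num.sqrt (1 + phi ^+ 2) = if c then - ico_a else ico_a.
  by rewrite /ico_a mul1r; case: c; rewrite ?expr1 ?expr0 ?mulN1r ?mul1r.
have qE (c : bool) : (-1) ^+ c * phi / Num.sqrt (1 + phi ^+ 2) = if c then - ico_b else ico_b.
  by rewrite /ico_b /ico_a mul1r; case: c; rewrite ?expr1 ?expr0 ?mulN1r ?mulNr ?mul1r.
apply/seteqP; split=> [v [a [b]]|v].
  by rewrite /= pE qE; case: a; case: b; case=> ->; rewrite !inE eqxx ?orbT.
rewrite /= !inE => vJ.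
have : exists a b : bool,
  let p := if a then - ico_a else ico_a in let q := if b then - ico_b else ico_b in
  [\/ v = vec3 0 p q, v = vec3 q 0 p | v = vec3 p q 0].
  move: vJ; do ![case/orP]; move=> /eqP->.
  - by exists true, false; constructor 3.
  - by exists true, false; constructor 1.
  - by exists true, false; constructor 2.
  - by exists false, true; constructor 2.
  - by exists false, true; constructor 3.
  - by exists false, true; constructor 1.
  - by exists false, false; constructor 1.
  - by exists false, false; constructor 2.
  - by exists false, false; constructor 3.
  - by exists true, true; constructor 3.
  - by exists true, true; constructor 1.
  - by exists true, true; constructor 2.
by case=> a [b] /= E; exists a, b; rewrite pE qE.
Qed.

(** * The jitterbug motion from the icosahedron to the cuboctahedron *)

Lemma jitterbug_unit a b : a ^+ 2 + b ^+ 2 = 1 -> unit_list (jitterbug a b).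
Proof.
move=> ab; rewrite /unit_list /= !dot_vec3.
by do ![apply/andP; split=> //]; apply/eqP; lra.
Qed.

Lemma jitterbug_dot a b m : 0 <= a -> 0 <= b -> a ^+ 2 <= b ^+ 2 ->
  a * b <= m -> b ^+ 2 - a ^+ 2 <= m ->
  pairwise (fun u v => dot u v <= m) (jitterbug a b).
Proof.
move=> a0 b0 ab m1 m2; have ab0 : 0 <= a * b by rewrite mulr_ge0.
have aa0 := sqr_ge0 a; rewrite /= !dot_vec3.
by do ![apply/andP; split=> //]; lra.
Qed.

Lemma is_DOD_jitterbug : Conf12 (config (jitterbug ico_a ico_b)) ->
  is_DOD (config (jitterbug ico_a ico_b)).
Proof.
apply: (labeled_copy_config _ _ _ _ rotation1 icosahedron_seq) => //.
by rewrite -[RHS]map_id; apply: eq_map => v; rewrite mulmx1.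
Qed.

Local Notation sqrt2 := (Num.sqrt (2 : R)).
Local Notation half := (sqrt2 / 2).

Lemma sqrt2K : sqrt2 ^+ 2 = 2.
Proof. by rewrite sqr_sqrtr. Qed.

Lemma polar_z_half : polar_z = 2 * half * sqrt3 / 3.
Proof.
rewrite -[RHS]ger0_norm -?sqrtr_sqr ?divr_ge0 ?mulr_ge0 ?sqrtr_ge0//.
by congr Num.sqrt; field: sqrt2K sqrt3K.
Qed.

(** The rows are the images in the cube of the three axes of the hexagonal frame:
    a vertex of the cuboctahedron orthogonal to [(1, 1, 1)], the vector that
    completes a direct frame, and the diagonal itself. *)
Definition cubic_frame : 'M[R]_3 :=
  mx3 (vec3 (- half) half 0)
      (vec3 (- half * sqrt3 / 3) (- half * sqrt3 / 3) (2 * half * sqrt3 / 3))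
      (vec3 (sqrt3 / 3) (sqrt3 / 3) (sqrt3 / 3)).

Lemma cubic_frame_rotation : is_rotation cubic_frame.
Proof. by apply: mx3_rotation; field: sqrt2K sqrt3K. Qed.

Lemma hex_cubic_frame x h z :
  hex x h (2 * half * sqrt3 / 3 * z) *m cubic_frame =
  vec3 (half * (- x - h + 2 / 3 * z)) (half * (x - h + 2 / 3 * z))
       (half * (2 * h + 2 / 3 * z)).
Proof. by rewrite vec3_mulmx !mxE/=; congr vec3; field: sqrt3K. Qed.

Lemma is_FCC_jitterbug : Conf12 (config (jitterbug half half)) ->
  is_FCC (config (jitterbug half half)).
Proof.
apply: (labeled_copy_config _ _ _ _ cubic_frame_rotation cuboctahedron_seq) => //.
rewrite polar_z_half -[2 * half * sqrt3 / 3]mulr1 -mulrN -(mulr0 (2 * half * sqrt3 / 3)).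
rewrite /= !hex_cubic_frame mulr0.
by rewrite /jitterbug /cyc/=; do ![congr (_ :: _)|congr vec3]; field.
Qed.

(** Interpolating squares linearly keeps [a ^+ 2 + b ^+ 2 = 1] along the path. The
    final value is [1 / 2] for both coordinates. *)
Definition blend c t := Num.sqrt ((1 - t) * c ^+ 2 + t / 2).

Definition FCC_path t := config (jitterbug (blend ico_a t) (blend ico_b t)).

Lemma blend0 c : 0 <= c -> blend c 0 = c.
Proof. by move=> c0; rewrite /blend subr0 mul1r mul0r addr0 sqrtr_sqr ger0_norm. Qed.

Lemma blend1 c : blend c 1 = half.
Proof.
rewrite /blend subrr mul0r add0r -[RHS]ger0_norm ?divr_ge0// -sqrtr_sqr.
by congr Num.sqrt; field: sqrt2K.
Qed.

Lemma continuous_blend c : continuous (blend c).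
Proof.
move=> t; rewrite /blend; apply: continuous_comp; last exact: sqrt_continuous.
apply: cvgD; apply: cvgMl; last exact: cvg_id.
by apply: cvgB; [exact: cvg_cst|exact: cvg_id].
Qed.

(** Along the path [b ^+ 2 - a ^+ 2] is [1 - t] times its initial value
    [ico_a * ico_b], which is below [1 / 2]. It stays positive before the final
    instant, so that [a] and [b] differ and [a * b < 1 / 2]. *)
Lemma FCC_path_Conf t : 0 <= t <= 1 ->
  Conf12 (FCC_path t) /\ (t < 1 -> Conf12_plus (FCC_path t)).
Proof.
move=> /andP[t0 t1]; have g := golden_gt; have g2 := golden_sq.
have a0 := ico_a_gt0; have aE := ico_a_sq.
have blendK c : blend c t ^+ 2 = (1 - t) * c ^+ 2 + t / 2.
  have : 0 <= (1 - t) * c ^+ 2 by rewrite mulr_ge0 ?sqr_ge0 ?subr_ge0.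
  by move=> ?; rewrite sqr_sqrtr//; lra.
have bE : ico_b ^+ 2 = (phi + 1) * ico_a ^+ 2 by rewrite /ico_b exprMn golden_sq.
set a := blend ico_a t; set b := blend ico_b t.
have a_ge0 : 0 <= a := sqrtr_ge0 _; have b_ge0 : 0 <= b := sqrtr_ge0 _.
have ab1 : a ^+ 2 + b ^+ 2 = 1.
  transitivity ((1 - t) * (ico_a ^+ 2 * (phi + 2)) + t); last by rewrite aE; ring.
  by rewrite !blendK bE; field.
have dE : b ^+ 2 - a ^+ 2 = (1 - t) * (phi * ico_a ^+ 2) by rewrite !blendK bE; ring.
have p1 : 0 < phi * ico_a ^+ 2 < 1 / 2.
  apply/andP; split; first by rewrite mulr_gt0 ?exprn_gt0//; lra.
  suff : 0 < ico_a ^+ 2 * (2 - phi) by lra.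
  rewrite mulr_gt0 ?exprn_gt0//; nra.
have d0 : 0 <= b ^+ 2 - a ^+ 2 by rewrite dE mulr_ge0//; lra.
have sq := sqr_ge0 (a - b).
pose m := Num.max (a * b) (b ^+ 2 - a ^+ 2).
have u := jitterbug_unit _ _ ab1.
have p : pairwise (fun u v => dot u v <= m) (jitterbug a b).
  by apply: jitterbug_dot; rewrite // ?le_max ?lexx ?orbT//; lra.
split=> [|t_lt1].
  apply: config_Conf12 p => //; rewrite ge_max; apply/andP; split; first by lra.
  rewrite dE; nra.
apply: config_Conf12_plus p => //; rewrite gt_max; apply/andP; split; last first.
  rewrite dE; nra.
have d1 : 0 < b ^+ 2 - a ^+ 2 by rewrite dE mulr_gt0//; lra.
have : 0 < (a - b) ^+ 2.
  by rewrite exprn_even_gt0//= subr_eq0; apply: contraTneq d1 => ->; rewrite subrr ltxx.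
lra.
Qed.

Lemma continuous_FCC_path : continuous FCC_path.
Proof.
move=> t; apply: (continuous_config (fun t => jitterbug (blend ico_a t) (blend ico_b t))) => i.
have ca := continuous_blend ico_a t; have cb := continuous_blend ico_b t.
rewrite /jitterbug /cyc /=; move: (nat_of_ord i) => {}i.
move: i; do 12?[apply: continuous_cons;
  try by [exact: ca|exact: cb|exact: cst_continuous|apply: continuousN]].
exact: continuous_nil.
Qed.

Lemma deformation_FCC : exists gamma : R -> 'M[R]_(12, 3),
    [/\ {within `[0, 1], continuous gamma},
        forall t : R, 0 <= t <= 1 -> Conf12 (gamma t),
        is_DOD (gamma 0), is_FCC (gamma 1) &
        forall t : R, 0 <= t < 1 -> Conf12_plus (gamma t)].
Proof.
have conf t : 0 <= t <= 1 -> Conf12 (FCC_path t) by move=> /FCC_path_Conf[].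
have g := golden_gt; have a0 := ico_a_gt0.
have b0 : 0 < ico_b by rewrite mulr_gt0//; lra.
exists FCC_path; split=> //.
- exact/continuous_subspaceT/continuous_FCC_path.
- have FCC_path0 : FCC_path 0 = config (jitterbug ico_a ico_b).
    by rewrite /FCC_path !blend0 ?ltW.
  rewrite FCC_path0; apply: is_DOD_jitterbug; rewrite -FCC_path0.
  by apply: conf; rewrite lexx ler01.
- have FCC_path1 : FCC_path 1 = config (jitterbug half half) by rewrite /FCC_path !blend1.
  rewrite FCC_path1; apply: is_FCC_jitterbug; rewrite -FCC_path1.
  by apply: conf; rewrite lexx ler01.
- by move=> t /andP[t0 t1]; apply: (FCC_path_Conf t _).2 => //; rewrite t0 ltW.
Qed.

(** * The twisting motion from the icosahedron to the orthobicupola *)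

(** The last triangle is the image of the third, and the first that of the second,
    under the half turn around the horizontal axis at longitude [pi / 6],
    which maps [(x, h, z)] to [((x + 3 * h) / 2, (x - h) / 2, - z)]. The first two
    triangles come from the equator, the last two are the polar ones. *)
Definition twisted x h z r w :=
  tri (r / 2) (- r / 2) w ++ tri r 0 (- w) ++
  tri x h z ++ tri ((x + 3 * h) / 2) ((x - h) / 2) (- z).

Lemma twisted_unit x h z r w : x ^+ 2 + 3 * h ^+ 2 + z ^+ 2 = 1 -> r ^+ 2 + w ^+ 2 = 1 ->
  unit_list (twisted x h z r w).
Proof.
move=> xhz rw; rewrite /unit_list /= !dot_hex.
by do ![apply/andP; split=> //]; apply/eqP; lra.
Qed.

(** The equation [r * (x - 3 * h) = 4 * (w * z)] says that the polar point
    [(x, h, z)] has the same dot product, [3 / 4 * (r * (x + h))], with the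
    equatorial points at longitudes [0] and [pi / 3]. The other bounds on
    [m] are, in the order of the hypotheses, for a polar point and the next
    equatorial point, for neighbours along the equator, within an equatorial
    triangle, within a polar triangle, and between the polar triangles. *)
Lemma twisted_dot x h z r w m :
  x ^+ 2 + 3 * h ^+ 2 + z ^+ 2 = 1 -> r ^+ 2 + w ^+ 2 = 1 ->
  r * (x - 3 * h) = 4 * (w * z) ->
  0 <= r * (x + h) -> 0 <= r * (x - 3 * h) ->
  3 / 4 * (r * (x + h)) <= m -> 3 / 4 * (r * (x - 3 * h)) <= m ->
  (1 - 3 * w ^+ 2) / 2 <= m -> (3 * w ^+ 2 - 1) / 2 <= m ->
  (3 * z ^+ 2 - 1) / 2 <= m -> 1 - 2 * z ^+ 2 <= m ->
  pairwise (fun u v => dot u v <= m) (twisted x h z r w).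
Proof.
move=> xhz rw bal rx rh m1 m2 m3 m4 m5 m6.
(* Half of the squares of [x - 3 * h], [2 * x] and [x + 3 * h] separate the
   dot products between the polar triangles from [1 - 2 * z ^+ 2]. *)
have s1 := sqr_ge0 x; have s2 := sqr_ge0 (x - 3 * h); have s3 := sqr_ge0 (x + 3 * h).
rewrite /= !dot_hex; do ![apply/andP; split=> //]; lra.
Qed.

(** The columns are the axes of the hexagonal frame in the coordinates of the
    cube. The first is the direction of the projection of the vertex
    [(0, ico_a, ico_b)] orthogonally to the diagonal [(1, 1, 1)], which puts that
    vertex at longitude [0]. *)
Definition threefold_frame : 'M[R]_3 :=
  (mx3 (vec3 (- (phi + 1) * sqrt3 / 6) ((2 - phi) * sqrt3 / 6) ((2 * phi - 1) * sqrt3 / 6))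
       (vec3 ((phi - 1) / 2) (- phi / 2) (1 / 2))
       (vec3 (sqrt3 / 3) (sqrt3 / 3) (sqrt3 / 3)))^T.

Lemma threefold_frame_rotation : is_rotation threefold_frame.
Proof.
by apply/trmx_rotation/mx3_rotation; field: sqrt3K golden_sq.
Qed.

Lemma vec3_threefold_frame x y z : vec3 x y z *m threefold_frame =
  hex (sqrt3 / 6 * (- (phi + 1) * x + (2 - phi) * y + (2 * phi - 1) * z))
      (sqrt3 / 6 * ((phi - 1) * x - phi * y + z)) (sqrt3 / 3 * (x + y + z)).
Proof.
by rewrite vec3_mulmx !mxE/=; congr vec3; field: sqrt3K.
Qed.

(** The projections of the vertices on the plane orthogonal to the diagonal have
    lengths [2 * sqrt3 / 3 * ico_a] and [2 * sqrt3 / 3 * ico_b], and their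
    heights are sums of coordinates divided by [sqrt3]. *)
Lemma is_DOD_twisted (s := twisted (2 * sqrt3 / 3 * ico_a) 0 (sqrt3 / 3 * (ico_a + ico_b))
   (2 * sqrt3 / 3 * ico_b) (sqrt3 / 3 * (ico_b - ico_a))) :
  Conf12 (config s) -> is_DOD (config s).
Proof.
apply: (labeled_copy_config _ _ _ _ threefold_frame_rotation icosahedron_seq) => //.
rewrite /= !vec3_threefold_frame /s /twisted /tri /ico_b /=.
by do ![congr (_ :: _)|congr hex]; field: golden_sq.
Qed.

Lemma is_HCP_twisted (s := twisted 2^-1 6^-1 polar_z 1 0) :
  Conf12 (config s) -> is_HCP (config s).
Proof.
apply: (labeled_copy_config _ _ _ _ rotation1 orthobicupola_seq) => //.
rewrite -[RHS]map_id; rewrite (eq_map (@mulmx1 _ _ _)) !map_id /s /twisted.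
by congr (_ ++ (_ ++ (_ ++ _))); congr tri; field.
Qed.

(** The parameter [b] is the horizontal displacement of a polar point orthogonally
    to the longitude [pi / 6] where it starts, and [cap_radial b] is
    [2 / sqrt3] times its component along that longitude. The two
    components run along the ellipse
    [3 / 4 * A ^+ 2 + (golden - 1) * b ^+ 2 = 1 / 3], the one through the
    polar points of both bicupola and icosahedron. As [golden - 1 < 1],
    the squared radius [3 / 4 * A ^+ 2 + b ^+ 2] grows with [b], so the polar
    triangle expands; as [golden - 1 > 0], the component [A] decreases, which
    moves the polar points away from their equatorial neighbours. *)
Definition cap_radial b := Num.sqrt (4 / 9 - 4 / 3 * (phi - 1) * b ^+ 2).
Definition cap_height b := Num.sqrt (2 / 3 - (2 - phi) * b ^+ 2).
(** An equatorial point of radius [r] and height [w] is balanced when [(r, w)] is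
    proportional to [(2 * cap_height b, b)]; this is the normalizing factor. *)
Definition belt_norm b := Num.sqrt (4 * cap_height b ^+ 2 + b ^+ 2).

Definition twist_list b :=
  twisted ((3 * cap_radial b + 2 * b) / 4) ((cap_radial b - 2 * b) / 4) (cap_height b)
          (2 * cap_height b / belt_norm b) (b / belt_norm b).

Lemma cap_radialK b : b ^+ 2 <= 1 / 10 ->
  cap_radial b ^+ 2 = 4 / 9 - 4 / 3 * (phi - 1) * b ^+ 2.
Proof.
move=> b1; have b2 := sqr_ge0 b; have g := golden_gt; have g2 := golden_sq.
rewrite sqr_sqrtr//; nra.
Qed.

Lemma cap_heightK b : b ^+ 2 <= 1 / 10 -> cap_height b ^+ 2 = 2 / 3 - (2 - phi) * b ^+ 2.
Proof.
move=> b1; have b2 := sqr_ge0 b; have g := golden_gt; have g2 := golden_lt.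
rewrite sqr_sqrtr//; nra.
Qed.

Lemma belt_normK b : belt_norm b ^+ 2 = 4 * cap_height b ^+ 2 + b ^+ 2.
Proof.
have h2 := sqr_ge0 (cap_height b); have b2 := sqr_ge0 b.
by rewrite sqr_sqrtr//; lra.
Qed.

Lemma cap_height_gt0 b : b ^+ 2 <= 1 / 10 -> 0 < cap_height b.
Proof.
move=> b1; have b2 := sqr_ge0 b; have g := golden_gt; have g2 := golden_lt.
rewrite sqrtr_gt0; nra.
Qed.

Lemma belt_norm_gt0 b : b ^+ 2 <= 1 / 10 -> 0 < belt_norm b.
Proof.
move=> b1; have b2 := sqr_ge0 b; have h0 := cap_height_gt0 _ b1.
by rewrite sqrtr_gt0 ltr_pwDl// mulr_gt0// exprn_gt0.
Qed.

(** Before the final instant [b] is positive, and then every critical dot product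
    is below [1 / 2]: [A < 2 / 3] and [r <= 1] for a polar point and its two
    neighbours, [w > 0] along the equator, and [z ^+ 2 < 2 / 3] in a polar
    triangle. The range of [b] contains the value [sqrt3 / 3 * ico_a], about
    [0.3035], of the icosahedron. *)
Lemma twist_Conf b : 0 <= b -> b ^+ 2 <= 1 / 10 ->
  Conf12 (config (twist_list b)) /\ (0 < b -> Conf12_plus (config (twist_list b))).
Proof.
move=> b0 b1; have b2 := sqr_ge0 b; have g := golden_gt; have g2 := golden_lt.
have z0 := cap_height_gt0 _ b1; have S0 := belt_norm_gt0 _ b1.
have AE := cap_radialK _ b1; have zE := cap_heightK _ b1; have SE := belt_normK b.
have A0 : 0 <= cap_radial b := sqrtr_ge0 _.
rewrite /twist_list; move: (cap_radial b) (cap_height b) (belt_norm b)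
  z0 S0 AE zE SE A0 => A z S z0 S0 AE zE SE A0.
set x := _ / 4; set h := _ / 4; set r := 2 * z / S; set w := b / S.
have xhA : x + h = A by rewrite /x /h; field.
have x3h : x - 3 * h = 2 * b by rewrite /x /h; field.
have xhz : x ^+ 2 + 3 * h ^+ 2 + z ^+ 2 = 1.
  transitivity (3 / 4 * A ^+ 2 + b ^+ 2 + z ^+ 2); first by rewrite /x /h; field.
  by rewrite AE zE; field.
have Sn0 : S != 0 by rewrite gt_eqF.
have wS : w * S = b by rewrite /w; field.
have rS : r * S = 2 * z by rewrite /r; field.
have rw : r ^+ 2 + w ^+ 2 = 1.
  apply: (mulIf (expf_neq0 2 Sn0)); rewrite mulrDl -!exprMn wS rS SE; ring.
have w0 : 0 <= w by rewrite divr_ge0// ltW.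
have r0 : 0 <= r by rewrite divr_ge0 ?mulr_ge0// ltW.
have w2 := sqr_ge0 w; have r2 := sqr_ge0 r.
have bal : r * (x - 3 * h) = 4 * (w * z) by rewrite x3h /r /w; field.
have pb1 : 0 <= (phi - 8 / 5) * b ^+ 2 by rewrite mulr_ge0//; lra.
have pb2 : 0 <= (17 / 10 - phi) * b ^+ 2 by rewrite mulr_ge0//; lra.
have z2 : 3 / 5 <= z ^+ 2 by rewrite zE; lra.
have z2u : z ^+ 2 <= 2 / 3 by rewrite zE; lra.
have S2 : 2 <= S ^+ 2 by rewrite SE; lra.
have w2u : w ^+ 2 <= 1 / 20.
  have wS2 : w ^+ 2 * S ^+ 2 = b ^+ 2 by rewrite -exprMn wS.
  have : 0 <= w ^+ 2 * (S ^+ 2 - 2) by rewrite mulr_ge0// subr_ge0.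
  lra.
have r1 : r <= 1 by rewrite -ler_sqr ?nnegrE// expr1n; lra.
have A1 : A <= 2 / 3 by rewrite -ler_sqr ?nnegrE//; lra.
have b3 : b <= 8 / 25 by rewrite -ler_sqr ?nnegrE//; lra.
(* The dot products of pairs that do not touch in the bicupola stay below the
   round constant [12 / 25], thanks to [b <= 8 / 25]. *)
pose m := Num.max (Num.max (3 / 4 * (r * A)) ((1 - 3 * w ^+ 2) / 2))
                  (Num.max ((3 * z ^+ 2 - 1) / 2) (12 / 25)).
have rA0 : 0 <= r * A by rewrite mulr_ge0.
have rb0 : 0 <= r * b by rewrite mulr_ge0.
have rb1 : r * b <= 8 / 25.
  have : 0 <= (1 - r) * b by rewrite mulr_ge0// subr_ge0.
  lra.
have rA1 : 0 <= (1 - r) * A by rewrite mulr_ge0// subr_ge0.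
have u := twisted_unit _ _ _ _ _ xhz rw.
have mge c : c <= 12 / 25 -> c <= m by move=> c1; rewrite !le_max c1 !orbT.
have p : pairwise (fun u v => dot u v <= m) (twisted x h z r w).
  apply: twisted_dot; rewrite // ?xhA ?x3h//; try (apply: mge; lra).
  - lra.
  - by rewrite !le_max lexx.
  - by rewrite !le_max lexx orbT.
  - by rewrite !le_max lexx orbT.
split=> [|b_gt0].
  apply: config_Conf12 p => //; rewrite !ge_max -!andbA; apply/and4P; split; lra.
apply: config_Conf12_plus p => //; rewrite !gt_max -!andbA.
have bb : 0 < b ^+ 2 by rewrite exprn_gt0.
have w_gt0 : 0 < w ^+ 2 by rewrite exprn_gt0// divr_gt0.
have A_lt : A < 2 / 3 by rewrite -ltr_sqr ?nnegrE//; lra.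
by apply/and4P; split; lra.
Qed.

(** In the three identities below, inserting the factor
    [ico_a ^+ 2 * (golden + 2) = 1] makes both sides homogeneous in [ico_a]. *)
Lemma cap_radial_ico : cap_radial (sqrt3 / 3 * ico_a) = 2 * sqrt3 / 3 * ico_a.
Proof.
have a0 := ico_a_gt0; apply: sqrtr_eq; first by rewrite !mulr_ge0// ltW.
transitivity (4 / 9 * (ico_a ^+ 2 * (phi + 2)) - 4 / 9 * (phi - 1) * ico_a ^+ 2).
  by rewrite ico_a_sq; field: sqrt3K.
by field: sqrt3K.
Qed.

Lemma cap_height_ico : cap_height (sqrt3 / 3 * ico_a) = sqrt3 / 3 * (ico_a + ico_b).
Proof.
have a0 := ico_a_gt0; have b0 : 0 < ico_b by rewrite mulr_gt0// (lt_trans _ golden_gt).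
apply: sqrtr_eq; first by rewrite !mulr_ge0// addr_ge0// ltW.
transitivity (2 / 3 * (ico_a ^+ 2 * (phi + 2)) - 1 / 3 * (2 - phi) * ico_a ^+ 2).
  by rewrite ico_a_sq; field: sqrt3K.
by rewrite /ico_b; field: sqrt3K golden_sq.
Qed.

Lemma belt_norm_ico : belt_norm (sqrt3 / 3 * ico_a) = phi.
Proof.
have g := golden_gt; apply: sqrtr_eq; first lra.
transitivity (phi ^+ 2 * (ico_a ^+ 2 * (phi + 2))); last by rewrite ico_a_sq mulr1.
by rewrite cap_height_ico /ico_b; field: sqrt3K golden_sq.
Qed.

Lemma twist_list_ico : twist_list (sqrt3 / 3 * ico_a) =
  twisted (2 * sqrt3 / 3 * ico_a) 0 (sqrt3 / 3 * (ico_a + ico_b))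
   (2 * sqrt3 / 3 * ico_b) (sqrt3 / 3 * (ico_b - ico_a)).
Proof.
have g := golden_gt; have g0 : phi != 0 by rewrite gt_eqF//; lra.
rewrite /twist_list cap_radial_ico cap_height_ico belt_norm_ico /ico_b.
congr twisted; try by field.
  by field: golden_sq.
by field: golden_sq.
Qed.

Lemma twist_list_flat : twist_list 0 = twisted 2^-1 6^-1 polar_z 1 0.
Proof.
have A : cap_radial 0 = 2 / 3 by apply: sqrtr_eq => //; rewrite expr0n mulr0 subr0; field.
have Z : cap_height 0 = polar_z by rewrite /cap_height expr0n mulr0 subr0.
have S : belt_norm 0 = 2 * polar_z.
  apply: sqrtr_eq; first by rewrite mulr_ge0.
  by rewrite Z; ring.
rewrite /twist_list A Z S; congr twisted; by field.
Qed.

Definition HCP_path t := config (twist_list ((1 - t) * (sqrt3 / 3 * ico_a))).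

Lemma continuous_tri_cat (x h z : R -> R) (F : R -> seq 'rV[R]_3) t :
  {for t, continuous x} -> {for t, continuous h} -> {for t, continuous z} ->
  (forall i j, {for t, continuous (fun t' => (F t')`_i 0 j)}) ->
  forall i j, {for t, continuous (fun t' => (tri (x t') (h t') (z t') ++ F t')`_i 0 j)}.
Proof.
move=> cx ch cz cF.
have cc c : {for t, continuous (fun _ : R => c)} by exact: cst_continuous.
have ch3 := continuousM (cc 3) ch.
apply: continuous_cons => //; first exact: continuousM.
apply: continuous_cons => //.
- by apply: continuousM => //; apply: continuousN; apply: continuousD.
- by apply: continuousM => //; apply: continuousM => //; apply: continuousB.
apply: continuous_cons => //.
- by apply: continuousM => //; apply: continuousB.
- by apply: continuousM => //; apply: continuousM => //; apply: continuousN; apply: continuousD.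
Qed.

Lemma continuous_twist b : b ^+ 2 <= 1 / 10 ->
  {for b, continuous (fun b => config (twist_list b))}.
Proof.
move=> b1; have S0 : belt_norm b != 0 by rewrite gt_eqF// belt_norm_gt0.
have cb : {for b, continuous (fun b : R => b)} by exact: cvg_id.
have cc c : {for b, continuous (fun b : R => c)} by exact: cst_continuous.
have cA : {for b, continuous cap_radial}.
  apply: (@continuous_comp _ _ _ _ Num.sqrt); last exact: sqrt_continuous.
  by apply: continuousB; [exact: cc|apply: continuousM; [exact: cc|exact: exprn_continuous]].
have cH : {for b, continuous cap_height}.
  apply: (@continuous_comp _ _ _ _ Num.sqrt); last exact: sqrt_continuous.
  by apply: continuousB; [exact: cc|apply: continuousM; [exact: cc|exact: exprn_continuous]].
have cS : {for b, continuous belt_norm}.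
  apply: (@continuous_comp _ _ _ _ Num.sqrt); last exact: sqrt_continuous.
  apply: continuousD; last exact: exprn_continuous.
  apply: continuousM; [exact: cc|].
  by apply: (@continuous_comp _ _ _ cap_height (fun x => x ^+ 2));
    [exact: cH|exact: exprn_continuous].
have cV : {for b, continuous (fun b => (belt_norm b)^-1)} by apply: continuousV.
have cR : {for b, continuous (fun b => 2 * cap_height b / belt_norm b)}.
  by apply: continuousM; first exact: continuousM.
have cW : {for b, continuous (fun b => b / belt_norm b)} by apply: continuousM.
have cB2 : {for b, continuous (fun b : R => 2 * b)} by apply: continuousM.
have cX : {for b, continuous (fun b => (3 * cap_radial b + 2 * b) / 4)}.
  by apply: continuousM => //; apply: continuousD => //; apply: continuousM.
have cK : {for b, continuous (fun b => (cap_radial b - 2 * b) / 4)}.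
  by apply: continuousM => //; apply: continuousB.
have cK3 := continuousM (cc 3) cK.
apply: continuous_config => i.
rewrite /twist_list /twisted; move: (nat_of_ord i) => {}i; move: i.
apply: continuous_tri_cat.
- by apply: continuousM.
- by apply: continuousM => //; apply: continuousN.
- exact: cW.
apply: continuous_tri_cat; [exact: cR|exact: cc|exact: continuousN|].
apply: continuous_tri_cat; [exact: cX|exact: cK|exact: cH|].
(* No list follows the last triangle, which is thus convertible to its
   concatenation with the empty list. *)
apply: (continuous_tri_cat
  (fun b => ((3 * cap_radial b + 2 * b) / 4
             + 3 * ((cap_radial b - 2 * b) / 4)) / 2)
  (fun b => ((3 * cap_radial b + 2 * b) / 4 - (cap_radial b - 2 * b) / 4) / 2)
  (fun b => - cap_height b) (fun _ => [::])).
- by apply: continuousM => //; apply: continuousD.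
- by apply: continuousM => //; apply: continuousB.
- exact: continuousN.
exact: continuous_nil.
Qed.

Lemma deformation_HCP : exists gamma : R -> 'M[R]_(12, 3),
    [/\ {within `[0, 1], continuous gamma},
        forall t : R, 0 <= t <= 1 -> Conf12 (gamma t),
        is_DOD (gamma 0), is_HCP (gamma 1) &
        forall t : R, 0 <= t < 1 -> Conf12_plus (gamma t)].
Proof.
have a0 := ico_a_gt0; have g := golden_gt; have aE := ico_a_sq.
have b0 : 0 < sqrt3 / 3 * ico_a by rewrite mulr_gt0// divr_gt0// sqrtr_gt0.
have bs : (sqrt3 / 3 * ico_a) ^+ 2 <= 1 / 10.
  have -> : (sqrt3 / 3 * ico_a) ^+ 2 = ico_a ^+ 2 / 3 by field: sqrt3K.
  have : 0 < ico_a ^+ 2 * (phi - 8 / 5) by rewrite mulr_gt0 ?exprn_gt0//; lra.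
  lra.
have b_ge0 t : 0 <= t <= 1 -> 0 <= (1 - t) * (sqrt3 / 3 * ico_a).
  by move=> /andP[_ t1]; rewrite mulr_ge0 ?subr_ge0// ltW.
have b_sq t : 0 <= t <= 1 -> ((1 - t) * (sqrt3 / 3 * ico_a)) ^+ 2 <= 1 / 10.
  move=> /andP[t0 t1]; rewrite exprMn; apply: le_trans bs.
  by rewrite ler_piMl ?sqr_ge0// expr_le1 ?subr_ge0//; lra.
have conf t : 0 <= t <= 1 -> Conf12 (HCP_path t).
  by move=> t01; exact: (twist_Conf _ (b_ge0 t t01) (b_sq t t01)).1.
exists HCP_path; split=> //.
- apply: continuous_in_subspaceT => t; rewrite inE/= in_itv/= => t01.
  apply: (@continuous_comp _ _ _ (fun t => (1 - t) * (sqrt3 / 3 * ico_a))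
                                 (fun b => config (twist_list b))).
    apply: continuousM; last exact: cst_continuous.
    by apply: continuousB; [exact: cst_continuous|exact: cvg_id].
  exact/continuous_twist/b_sq.
- have E : HCP_path 0 = config (twist_list (sqrt3 / 3 * ico_a)) by rewrite /HCP_path subr0 mul1r.
  rewrite E twist_list_ico; apply: is_DOD_twisted; rewrite -twist_list_ico -E.
  by apply: conf; rewrite lexx ler01.
- have E : HCP_path 1 = config (twist_list 0) by rewrite /HCP_path subrr mul0r.
  rewrite E twist_list_flat; apply: is_HCP_twisted; rewrite -twist_list_flat -E.
  by apply: conf; rewrite lexx ler01.
- move=> t /andP[t0 t1]; have t01 : 0 <= t <= 1 by rewrite t0 ltW.
  by apply: (twist_Conf _ (b_ge0 t t01) (b_sq t t01)).2; rewrite mulr_gt0// subr_gt0.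
Qed.

End TwelveSpheres.

Theorem theorem5p5 (R : realType) :
  (exists gamma : R -> 'M[R]_(12, 3),
    [/\ {within `[0, 1], continuous gamma},
        forall t : R, 0 <= t <= 1 -> Conf12 (gamma t),
        is_DOD (gamma 0), is_FCC (gamma 1) &
        forall t : R, 0 <= t < 1 -> Conf12_plus (gamma t)]) /\
  (exists gamma : R -> 'M[R]_(12, 3),
    [/\ {within `[0, 1], continuous gamma},
        forall t : R, 0 <= t <= 1 -> Conf12 (gamma t),
        is_DOD (gamma 0), is_HCP (gamma 1) &
        forall t : R, 0 <= t < 1 -> Conf12_plus (gamma t)]).
Proof.
by split; [exact: deformation_FCC|exact: deformation_HCP].
Qed.
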